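(* Let $X\neq\{0\}$ be a real Banach space with the Daugavet property. Then there exists a non-convex bounded set $U\subset X$ which is not SCD but which has a determining sequence $(U_n)_{n\in\mathbb N}$ consisting of (non-empty) relatively weakly open subsets of $U$.
   Context: All Banach spaces are real. For a non-empty bounded set $A \subset X$, a slice of $A$ is a (non-empty) set of the form $S(A,x^*,\varepsilon)=\{x\in A : x^*(x) > \sup_{a\in A} x^*(a)-\varepsilon\}$ with $x^*\in X^*\setminus\{0\}$ and $\varepsilon>0$. A sequence $(U_n)_{n\in\mathbb N}$ of non-empty subsets of a bounded set $A\subset X$ is called determining (for $A$) if for every $B\subset X$ with $B\cap U_n\neq\emptyset$ for all $n$ one has $A\subset\overline{\mathrm{conv}}(B)$ (norm-closed convex hull). A bounded set $A$ is SCD (slicely countably determined) if it has a determining sequence consisting of slices of $A$. A Banach space $X$ has the Daugavet property if every bounded linear rank-one operator $T\colon X\to X$ satisfies $\|I+T\|=1+\|T\|$. *)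

(* Defs.v *)
From HB Require Import structures.
From mathcomp Require Import all_boot all_order all_algebra.
From mathcomp Require Import all_classical all_reals all_analysis.
Import Order.TTheory GRing.Theory Num.Theory.
Import numFieldNormedType.Exports.

Set Implicit Arguments.
Unset Strict Implicit.
Unset Printing Implicit Defensive.

Local Open Scope classical_set_scope.
Local Open Scope ring_scope.

Section OperatorNorm.
Context {R : realType} {X Y : normedModType R}.

(* The [sup] of an unbounded set is a junk value; this is only used on bounded
   operators. *)
Definition opnorm (f : X -> Y) : R :=
  sup [set `|f x| | x in [set x : X | `|x| <= 1]].

Definition rank_one (T : X -> Y) : Prop :=
  exists2 e : Y, e != 0 & range T = range (fun a : R => a *: e).

End OperatorNorm.

(* For linear maps, [continuous] is equivalent to boundedness
   ([linear_bounded_continuous]). *)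
Definition daugavet_property {R : realType} (X : normedModType R) : Prop :=
  forall T : {linear X -> X}, continuous T -> rank_one T ->
    opnorm (fun x => x + T x) = 1 + opnorm T.

Definition dual {R : realType} (X : normedModType R) : Type :=
  {f : {linear X -> R^o} | continuous f}.

Definition dual_fun {R : realType} {X : normedModType R} (f : dual X) :
  X -> R := sval f.
Coercion dual_fun : dual >-> Funclass.

(* [X] with its weak topology: the coarsest one making every element of the dual
   continuous. *)
Definition weak_space {R : realType} (X : normedModType R) : topologicalType :=
  sup_topology (fun f : dual X =>
    Topological.class (initial_topology (f : X -> R^o))).

Section SlicelyCountablyDetermined.
Context {R : realType} {X : normedModType R}.
Implicit Types (A B S V : set X) (U : nat -> set X).

Definition slice A (f : dual X) (eps : R) : set X :=
  [set x | A x /\ sup (f @` A) - eps < f x].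

Definition is_slice A S : Prop :=
  S !=set0 /\
  exists f : dual X, exists eps : R,
    [/\ exists x, f x != 0, 0 < eps & S = slice A f eps].

Definition relatively_weakly_open A V : Prop :=
  exists2 W : set (weak_space X), open W & V = A `&` (W : set X).

Definition convex_hull B : set X := smallest (@convex_set R X) B.

Definition determining A U : Prop :=
  (forall n, U n !=set0 /\ U n `<=` A) /\
  forall B, (forall n, B `&` U n !=set0) -> A `<=` closure (convex_hull B).

(* [slice] and [scd] are only meant for a non-empty bounded [A] ([sup] is junk
   otherwise). *)
Definition scd A : Prop :=
  exists U, (forall n, is_slice A (U n)) /\ determining A U.

End SlicelyCountablyDetermined.

(* Main.v *)
Require Import Defs.
From HB Require Import structures.
From mathcomp Require Import all_boot all_order all_algebra.
From mathcomp Require Import all_classical all_reals all_analysis.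
From mathcomp Require Import ring lra.
Import Order.TTheory GRing.Theory Num.Theory.
Import numFieldNormedType.Exports.

Local Open Scope classical_set_scope.
Local Open Scope ring_scope.

(** The set U is a countable union of finite stages. It is so scattered that each
of its points is weakly isolated, so that its singletons form a determining
sequence; but from the point of view of slices it looks like a ball of a
Daugavet space, which is as far from being slicely countably determined as
possible.

Fix a functional phi and e with phi e = 1, and r > |e|. All points of U are
convex combinations of a point of the face {phi = 1, |x| < r} and a point of the
opposite face {phi = -1, |x| < r} ([between_faces]). Starting from u0 = e / 2, the
n-th stage is a finite symmetric set s_n with the following properties
([next_stage]), where tol_n is a summable sequence:
 - all points y of s_n satisfy 1 - tol_n < |phi y| < 1;
 - every point constructed before stage n is within tol_n of the convex hull of s_n;
 - adding a multiple l y, |l| <= 1, of a point y of s_n to an element v of the set K_n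
   of all sums u0 + l_1 y_1 + ... with at most one term from each earlier stage
   decreases the norm of v by at most tol_n ([almost_orthogonal]).

By the first property only finitely many points of U satisfy |phi x| < c when
c < 1. Hence a point u of U is isolated, for the weak topology, by the strip
|phi x| < (1 + |phi u|) / 2 and by finitely many functionals ([tower_discrete]).
A strip is not a slice: by the second property, a slice of U that contains
some point meets every sufficiently late stage. So, given slices S_n, there are
points y_n of S_n taken from distinct stages. By the third property the
differences u0 - c, with c in the convex hull of the y_n, have norms bounded
below, and the slices are not determining ([tower_not_scd]).

It remains to find a stage. For a point a of a face, the Hahn-Banach separation
theorem reduces the approximation of a by convex combinations of admissible
points to finding, for one functional f at a time, an admissible y with phi y
close to phi a and f y close to f a. In a Daugavet space every slice of a ball
contains points that are almost orthogonal to a given totally bounded set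
([daugavet_slice_orthogonal]). To control two functionals at once, y is an
average of such points, chosen one after the other, each in a slice that pushes
the accumulated error in R^2 back towards 0; the error of a sum of m terms is
then of order sqrt m ([daugavet_weak_approximation]). *)

(** * The Hahn-Banach theorem *)

Section HahnBanach.
Context {R : realType} {V : lmodType R}.
Implicit Types (p q : V -> R) (u v w : V).

(** Requiring only an inequality for homogeneity makes the class visibly stable
under infima; the equality follows for s > 0 by applying it to the inverse of s. *)
Definition sublinear p :=
  (forall s v, 0 <= s -> p (s *: v) <= s * p v) /\
  (forall u v, p (u + v) <= p u + p v).

Lemma sublinear0 p : sublinear p -> p 0 = 0.
Proof.
move=> [ph pD]; have := ph 0 0 (lexx _); have := pD 0 0.
rewrite scale0r addr0 mul0r; lra.
Qed.

Lemma sublinear_geN p v : sublinear p -> - p (- v) <= p v.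
Proof. by move=> sp; have := sp.2 v (- v); rewrite subrr sublinear0//; lra. Qed.

(** The infimum of a family that is directed in this weak sense is sublinear. It
serves for chains of sublinear functions, for the translates in
[minimal_sublinear_linear] and for the gauge in [Hahn_Banach_separation]. *)
Lemma sublinear_inf (I : Type) (D : set I) (F : I -> V -> R) :
  D !=set0 ->
  (forall v, exists m, forall i, D i -> m <= F i v) ->
  (forall i s v, D i -> 0 <= s -> exists2 j, D j & F j (s *: v) <= s * F i v) ->
  (forall i j u v, D i -> D j ->
    exists2 k, D k & F k (u + v) <= F i u + F j v) ->
  sublinear (fun v => inf [set F i v | i in D]).
Proof.
move=> [i0 Di0] Fm Fh FD.
have ne v : [set F i v | i in D] !=set0 by exists (F i0 v), i0.
have le_F v i : D i -> inf [set F j v | j in D] <= F i v.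
  move=> Di; apply: ge_inf; last by exists i.
  by have [m mF] := Fm v; exists m => _ [j Dj <-]; exact: mF.
split=> [s v|u v].
  rewrite le_eqVlt => /predU1P[<-|s0].
    have [j Dj jF] := Fh i0 0 v Di0 (lexx _).
    rewrite !mul0r in jF *.
    apply: le_trans (le_F _ _ Dj) jF.
  rewrite mulrC -ler_pdivrMr//; apply: lb_le_inf => // _ [i Di <-].
  have [j Dj jF] := Fh i s v Di (ltW s0).
  by rewrite ler_pdivrMr// mulrC; exact: le_trans (le_F _ _ Dj) jF.
rewrite -lerBlDr; apply: lb_le_inf => // _ [i Di <-].
rewrite lerBlDr -lerBlDl; apply: lb_le_inf => // _ [j Dj <-].
have [k Dk kF] := FD i j u v Di Dj.
by rewrite lerBlDl; exact: le_trans (le_F _ _ Dk) kF.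
Qed.

(** For a fixed w, the infimum over t >= 0 of q (v + t w) - t q w is sublinear in v and
below q, hence equal to q. At v = - w, the term t = 1 shows q (- w) <= - q w; so q is
odd, and an odd sublinear function is linear. *)
Lemma minimal_sublinear_linear q : sublinear q ->
  (forall r, sublinear r -> (forall v, r v <= q v) -> forall v, q v <= r v) ->
  forall a u v, q (a *: u + v) = a * q u + q v.
Proof.
move=> sq qmin.
have [qh qD] := sq.
have qN w : q (- w) = - q w.
  pose F t v := q (v + t *: w) - t * q w.
  have Fm v : exists m, forall t, 0 <= t -> m <= F t v.
    exists (- q (- v)) => t t0.
    have := qD (v + t *: w) (- v); rewrite addrC addrA addNr add0r /F.
    have : t * q w <= q (t *: w).
      move: t0; rewrite le_eqVlt => /predU1P[<-|t0].
        by rewrite scale0r mul0r sublinear0.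
      have := qh t^-1 (t *: w); rewrite invr_ge0 ltW// scalerA mulVf ?gt_eqF//.
      by rewrite scale1r ler_pdivlMl// => /(_ isT).
    lra.
  have sr : sublinear (fun v => inf [set F t v | t in [set t | 0 <= t]]).
    apply: sublinear_inf => //.
    - by exists 0 => /=.
    - move=> t s v t0 s0; exists (s * t); first exact: mulr_ge0.
      rewrite /F -scalerA -scalerDr mulrBr mulrA lerB//; exact: qh.
    - move=> t1 t2 u v t10 t20; exists (t1 + t2); first exact: addr_ge0.
      have := qD (u + t1 *: w) (v + t2 *: w).
      by rewrite /F addrACA -scalerDl; lra.
  have le_F v t : 0 <= t -> inf [set F t v | t in [set t | 0 <= t]] <= F t v.
    move=> t0; apply: ge_inf; last by exists t.
    by have [m mF] := Fm v; exists m => _ [j Dj <-]; exact: mF.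
  have := qmin _ sr _ (- w).
  move=> /(_ _)/le_trans; rewrite /F => h.
  apply/eqP; rewrite eq_le; apply/andP; split; last first.
    by have := sublinear_geN _ (- w) sq; rewrite opprK; lra.
  apply: le_trans (h _ _ (le_F (- w) 1 ler01)) _.
    move=> v; have := le_F v 0 (lexx _).
    by rewrite /F scale0r addr0 mul0r subr0.
  by rewrite /F scale1r addNr sublinear0// mul1r sub0r.
have qA u v : q (u + v) = q u + q v.
  apply/eqP; rewrite eq_le qD /=.
  by have := qD (u + v) (- v); rewrite addrK qN; lra.
have qZ s v : 0 <= s -> q (s *: v) = s * q v.
  move=> s0; apply/eqP; rewrite eq_le qh//=.
  by have := qh s (- v) s0; rewrite scalerN !qN; lra.
move=> a u v; rewrite qA; congr (_ + _).
have [a0|a0] := leP 0 a; first exact: qZ.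
have := qZ (- a) u; rewrite scaleNr qN oppr_ge0 ltW// => /(_ isT); lra.
Qed.

(** A minimal element among the sublinear functions below p exists by Zorn's lemma,
without any extension of partial functionals. *)
Theorem Hahn_Banach p : sublinear p -> exists f : V -> R,
  (forall a u v, f (a *: u + v) = a * f u + f v) /\ forall v, f v <= p v.
Proof.
move=> sp.
pose T := {q : V -> R | sublinear q /\ forall v, q v <= p v}.
pose mk q h : T := exist (fun q => sublinear q /\ forall v, q v <= p v) q h.
pose le_T (q r : T) := `[< forall v, sval r v <= sval q v >].
have [||||q qmin] := @Zorn T le_T.
- by move=> q; apply/asboolP => v.
- move=> q r s /asboolP qr /asboolP rs; apply/asboolP => v.
  exact: le_trans (rs v) (qr v).
- move=> [q hq] [r hr] /asboolP/= qr /asboolP/= rq; apply: eq_exist.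
  by apply/funext => v; apply/le_anti; rewrite qr rq.
- move=> A Atot; have [[q0 Aq0]|A0] := pselect (A !=set0); last first.
    exists (mk p (conj sp (fun v => lexx _))) => q Aq.
    by exfalso; apply: A0; exists q.
  pose F (q : T) v := sval q v.
  have Fm v : exists m, forall q : T, A q -> m <= F q v.
    exists (- p (- v)) => q _; rewrite /F; case: (svalP q) => sq qp.
    by apply: le_trans (sublinear_geN _ v sq); rewrite lerN2; exact: qp.
  have si : sublinear (fun v => inf [set F q v | q in A]).
    apply: sublinear_inf => //.
    - by exists q0.
    - by move=> q s v Aq s0; exists q => //; have [[+ _] _] := svalP q; exact.
    - move=> q r u v Aq Ar; have [/asboolP|/asboolP] := Atot q r Aq Ar => h.
        exists r => //; have [[_ +] _] := svalP r => /(_ u v).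
        by have := h u; rewrite /F; lra.
      exists q => //; have [[_ +] _] := svalP q => /(_ u v).
      by have := h v; rewrite /F; lra.
  have le_F v (q : T) : A q -> inf [set F q v | q in A] <= F q v.
    move=> Aq; apply: ge_inf; last by exists q.
    by have [m mF] := Fm v; exists m => _ [j Dj <-]; exact: mF.
  have ip v : inf [set F q v | q in A] <= p v.
    by apply: le_trans (le_F v _ Aq0) _; have [_] := svalP q0; exact.
  exists (mk _ (conj si ip)) => q Aq; apply/asboolP => v.
  exact: le_F.
have [sq qp] := svalP q.
exists (sval q); split=> //; apply: minimal_sublinear_linear => // r sr rq v.
have rp w : r w <= p w by exact: le_trans (rq w) (qp w).
by rewrite -(qmin (mk r (conj sr rp)))//; apply/asboolP.
Qed.

End HahnBanach.

(** * Bounded functionals and separation *)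

Section Functionals.
Context {R : realType} {X : normedModType R}.
Implicit Types (f g : X -> R) (u v x : X) (T : set X).

(** The elements of the dual as plain functions, so that linear combinations of
them are written as such. *)
Definition functional f :=
  (forall a u v, f (a *: u + v) = a * f u + f v) /\
  exists2 M, 0 < M & forall v, `|f v| <= M * `|v|.

Lemma functionalD f u v : functional f -> f (u + v) = f u + f v.
Proof. by move=> [fL _]; have := fL 1 u v; rewrite scale1r mul1r. Qed.

Lemma functional0 f : functional f -> f 0 = 0.
Proof.
by move=> hf; have := functionalD _ 0 0 hf; rewrite addr0; lra.
Qed.

Lemma functionalZ f a u : functional f -> f (a *: u) = a * f u.
Proof.
by move=> hf; have := hf.1 a u 0; rewrite addr0 functional0// addr0.
Qed.

Lemma functionalN f u : functional f -> f (- u) = - f u.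
Proof. by move=> hf; rewrite -scaleN1r functionalZ// mulN1r. Qed.

Lemma functionalB f u v : functional f -> f (u - v) = f u - f v.
Proof. by move=> hf; rewrite functionalD// functionalN. Qed.

Lemma functional_comb a b f g : functional f -> functional g ->
  functional (fun x => a * f x + b * g x).
Proof.
move=> hf hg; split=> [c u v|]; first by rewrite hf.1 hg.1; ring.
have [_ [M M0 fM]] := hf; have [_ [N N0 gN]] := hg.
exists (`|a| * M + `|b| * N + 1) => [|v].
  by rewrite ltr_wpDl// addr_ge0// mulr_ge0// ltW.
rewrite (le_trans (ler_normD _ _))// !normrM !mulrDl mul1r.
rewrite -[leLHS]addr0 lerD// -!mulrA lerD// ler_wpM2l//.
Qed.

Lemma contractive_functional f : (forall a u v, f (a *: u + v) = a * f u + f v) ->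
  (forall v, f v <= `|v|) -> functional f /\ forall v, `|f v| <= `|v|.
Proof.
move=> fL f1.
have fN v : f (- v) = - f v.
  have f0 : f 0 = 0 by have := fL 1 0 0; rewrite scale1r addr0 mul1r; lra.
  by have := fL (- 1) v 0; rewrite scaleN1r addr0 f0 addr0 mulN1r.
have f1' v : `|f v| <= `|v|.
  by rewrite ler_norml f1 andbT lerNl -fN -[leRHS]normrN f1.
by split=> //; split=> //; exists 1 => // v; rewrite mul1r.
Qed.

Lemma dual_functional (f : dual X) : functional f.
Proof.
case: f => f fc; split=> [a u v|]; first by rewrite /dual_fun /= linearP.
have /linear_boundedP := (linear_bounded_continuous f).2 fc.
by move=> /pinfty_ex_gt0[M M0 fM]; exists M.
Qed.

Lemma functional_dual f : functional f -> exists g : dual X, (g : X -> R) = f.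
Proof.
move=> [fL [M M0 fM]].
have lf : linear (f : X -> R^o) by move=> a u v; exact: fL.
pose g : {linear X -> R^o} := HB.pack (f : X -> R^o) (GRing.isLinear.Build R X R^o *:%R f lf).
suff gc : continuous g by exists (exist _ g gc).
apply/linear_bounded_continuous/linear_boundedP.
exists M; split; first exact: gtr0_real.
move=> N MN v; apply: le_trans (fM v) _.
by rewrite ler_wpM2r// ltW.
Qed.

Lemma convex_setP T : convex_set T <->
  forall u v s, T u -> T v -> 0 <= s -> s <= 1 -> T (s *: u + (1 - s) *: v).
Proof.
split=> [cT u v s Tu Tv s0 s1|cT u v s].
  have := cT u v (Itv01 s0 s1).
  by rewrite !inE => /(_ Tu Tv).
rewrite !inE => Tu Tv.
by apply: cT => //; rewrite ?ge0 ?le1.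
Qed.

(** A linear functional below the infimum of |v + s (a - t)| - s e over s >= 0 and t in T
is contractive, by s = 0, and separates a from T by e, by s = 1 and v = t - a. That
this infimum is finite uses that T is at distance at least e from a. *)
Lemma Hahn_Banach_separation T a e : convex_set T -> 0 <= e ->
  (forall t, T t -> e <= `|a - t|) ->
  exists f, [/\ functional f, (forall v, `|f v| <= `|v|) &
    forall t, T t -> f t + e <= f a].
Proof.
move=> /convex_setP cT e0 Te.
have [[t0 Tt0]|T0] := pselect (T !=set0); last first.
  exists (fun=> 0); split=> //.
  - split; first by move=> *; rewrite mulr0 addr0.
    by exists 1 => // v; rewrite normr0 mul1r.
  - by move=> v; rewrite normr0.
  - by move=> t Tt; exfalso; apply: T0; exists t.
pose D := [set i : R * X | 0 <= i.1 /\ T i.2].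
pose F (i : R * X) v := `|v + i.1 *: (a - i.2)| - i.1 * e.
have Fm v : exists m, forall i, D i -> m <= F i v.
  exists (- `|v|) => -[s t] [/= s0 Tt]; rewrite /F /=.
  have := ler_normB (v + s *: (a - t)) v.
  rewrite addrAC subrr add0r normrZ ger0_norm//.
  by have := ler_wpM2l s0 (Te t Tt); lra.
have le_F v i : D i -> inf [set F i v | i in D] <= F i v.
  move=> Di; apply: ge_inf; last by exists i.
  by have [m mF] := Fm v; exists m => _ [j Dj <-]; exact: mF.
have [|f [fL fp]] := @Hahn_Banach _ _ (fun v => inf [set F i v | i in D]).
  apply: sublinear_inf => //.
  - by exists (0, t0); split.
  - move=> [s t] c v [/= s0 Tt] c0; exists (c * s, t).
      by split=> //=; exact: mulr_ge0.
    by rewrite /F/= -scalerA -scalerDr normrZ ger0_norm// mulrBr mulrA.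
  - move=> [s t] [s' t'] u v [/= s0 Tt] [/= s'0 Tt'].
    have [ss0|ss0] := eqVneq (s + s') 0.
      exists (0, t); first by split.
      have [-> ->] : s = 0 /\ s' = 0 by split; lra.
      by rewrite /F/= !scale0r !addr0 mul0r !subr0; exact: ler_normD.
    have ss : 0 < s + s' by rewrite lt_neqAle eq_sym ss0 addr_ge0.
    have E : 1 - s / (s + s') = s' / (s + s') by field.
    exists (s + s', s / (s + s') *: t + (1 - s / (s + s')) *: t').
      split=> /=; first exact: ltW.
      apply: cT => //; first by rewrite divr_ge0// ltW.
      by rewrite ler_pdivrMr// mul1r lerDl.
    have -> : F (s + s', s / (s + s') *: t + (1 - s / (s + s')) *: t') (u + v) =
       `|(u + s *: (a - t)) + (v + s' *: (a - t'))| - s * e - s' * e.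
      rewrite /F/= E -[RHS]addrA -opprD -mulrDl; congr (Num.norm _ - _).
      rewrite [in RHS]addrACA; congr (_ + _).
      rewrite !scalerBr scalerDl scalerDr !scalerA.
      rewrite ![(s + s') * _]mulrC -!mulrA mulVf// !mulr1.
      by rewrite opprD addrACA.
    by have := ler_normD (u + s *: (a - t)) (v + s' *: (a - t')); rewrite /F/=; lra.
have f1 v : f v <= `|v|.
  apply: le_trans (fp v) (le_trans (le_F v (0, t0) _) _) => //.
  by rewrite /F/= scale0r addr0 mul0r subr0.
have [ff f1'] := contractive_functional _ fL f1.
exists f; split=> // t Tt.
have := le_trans (fp (- (a - t))) (le_F (- (a - t)) (1, t) (conj ler01 Tt)).
rewrite /F/= scale1r addNr normr0 mul1r sub0r functionalN// functionalB//; lra.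
Qed.

Lemma norming_functional x : exists f,
  [/\ functional f, (forall v, `|f v| <= `|v|) & f x = `|x|].
Proof.
have c0 : convex_set [set 0 : X].
  by apply/convex_setP => u v s -> -> _ _; rewrite !scaler0 addr0.
have [||f [ff f1 fx]] := @Hahn_Banach_separation [set 0] x `|x| c0 => //.
  by move=> t ->; rewrite subr0.
exists f; split=> //; apply/le_anti.
have := fx 0 erefl; rewrite functional0// add0r => ->.
by rewrite (le_trans (ler_norm _)).
Qed.

End Functionals.

(** * Slices of balls in Daugavet spaces *)

Section DaugavetSlices.
Context {R : realType} {X : normedModType R}.
Hypothesis X_neq0 : exists x : X, x != 0.
Hypothesis X_daugavet : daugavet_property X.
Implicit Types (f g : X -> R) (u v w x y z : X) (K : set X).

Lemma opnorm_rank_one f x : functional f -> (exists v, f v != 0) -> `|x| = 1 ->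
  opnorm (fun v => v + f v *: x) = 1 + opnorm (fun v => f v *: x).
Proof.
move=> ff [v0 fv0] x1.
pose T0 (v : X) : X := f v *: x.
have lT : linear T0 by move=> a u v; rewrite /T0 ff.1 scalerDl scalerA.
pose T : {linear X -> X} := HB.pack T0 (GRing.isLinear.Build R X X *:%R T0 lT).
apply: (X_daugavet T).
- apply/linear_bounded_continuous/linear_boundedP.
  have [_ [M M0 fM]] := ff; exists M; split; first exact: gtr0_real.
  move=> N MN v; rewrite /= /T0 normrZ x1 mulr1 (le_trans (fM v))//.
  by rewrite ler_wpM2r// ltW.
- exists x; first by rewrite -normr_eq0 x1 oner_neq0.
  apply/seteqP; split=> _ [v _ <-]; first by exists (f v).
  exists ((v / f v0) *: v0) => //=.
  by rewrite /T0 functionalZ// mulfVK.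
Qed.

(** Let s = |f| and x1 = x / |x|. As |I + f x1| = 1 + s, some z of the unit ball makes
z + f z x1 have norm almost 1 + s; let g norm this vector. Then f z is almost s, and
g z and g x1 are almost 1. So f + g takes a value close to 1 + s at z, and any w in
the ball where it is that large has f w close to s and g w close to 1: the slice of
f + g lies in that of f, and on it g bounds |x + l w| from below. *)
Lemma daugavet_subslice_neq0 f alpha x0 x eta : functional f ->
  (exists v, f v != 0) -> `|x0| <= 1 -> alpha < f x0 -> 0 < eta -> x != 0 ->
  exists g beta z, [/\ functional g, `|z| <= 1, beta < g z &
    forall w, `|w| <= 1 -> beta < g w ->
      alpha < f w /\ forall l, 0 <= l -> `|x| - eta <= `|x + l *: w|].
Proof.
move=> ff fne0 x01 fx0 eta0 xne0.
have nx0 : 0 < `|x| by rewrite normr_gt0.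
pose x1 := `|x|^-1 *: x.
have x11 : `|x1| = 1.
  by rewrite normrZ ger0_norm ?invr_ge0// mulVf// normr_eq0.
set s := opnorm (fun v => f v *: x1).
have hs : has_ubound [set `|f v *: x1| | v in [set v : X | `|v| <= 1]].
  have [_ [M M0 fM]] := ff; exists M => _ [v /= v1 <-].
  by rewrite normrZ x11 mulr1 (le_trans (fM v))// ler_piMr// ltW.
have fs v : `|v| <= 1 -> `|f v| <= s.
  move=> v1; apply: (ub_le_sup hs); exists v => //.
  by rewrite normrZ x11 mulr1.
have s0 : 0 < s.
  have [v fv0] := fne0.
  have v0 : v != 0.
    by apply: contraNN fv0 => /eqP ->; rewrite functional0.
  have := fs (`|v|^-1 *: v); rewrite normrZ functionalZ// normrM.
  rewrite ger0_norm ?invr_ge0// mulVf ?normr_eq0// => /(_ (lexx _)).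
  by apply: lt_le_trans; rewrite mulr_gt0// ?invr_gt0 normr_gt0.
have als : alpha < s.
  by rewrite (lt_le_trans fx0)// (le_trans (ler_norm _))// fs.
pose d := Num.min ((s - alpha) / 2) (Num.min (1 / 2) (Num.min (s / 2) (eta * s / `|x|))).
have d0 : 0 < d.
  by rewrite !lt_min !divr_gt0 ?subr_gt0 ?mulr_gt0.
have d1 : d <= (s - alpha) / 2 by rewrite ge_min lexx.
have d2 : d <= 1 / 2 by rewrite !ge_min lexx orbT.
have d4 : d <= s / 2 by rewrite !ge_min lexx !orbT.
have d3 : d <= eta * s / `|x| by rewrite !ge_min lexx !orbT.
have [z z1 zs] : exists2 z, `|z| <= 1 & 1 + s - d < `|z + f z *: x1|.
  have : 1 + s - d < opnorm (fun v => v + f v *: x1).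
    by rewrite opnorm_rank_one//; rewrite -/s ltrBlDr ltrDl.
  move=> /sup_gt[|_ [z /= z1 <-] zs]; last by exists z.
  by exists `|0 + f 0 *: x1|, 0 => //=; rewrite normr0.
have [g [fg g1 gz]] := norming_functional (z + f z *: x1).
have {zs} : 1 + s - d < g z + f z * g x1.
  by rewrite -functionalZ// -functionalD// gz.
(* change of sign of both z and g keeps g z and f z * g x1 *)
wlog fz0 : z g fg g1 z1 {gz} / 0 <= f z.
  move=> wl; have [fz0|fz0] := leP 0 (f z); first exact: wl.
  move=> zs; apply: (wl (- z) (fun v => - g v)).
  - have := functional_comb (- 1) 0 _ _ fg fg.
    by under eq_fun do rewrite mulN1r mul0r addr0.
  - by move=> v; rewrite normrN.
  - by rewrite normrN.
  - by rewrite functionalN// oppr_ge0 ltW.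
  - by rewrite (functionalN g)// (functionalN f)// opprK mulrNN.
move=> zs.
have gz1 : g z <= 1.
  by rewrite (le_trans (ler_norm _))// (le_trans (g1 z)).
have gx1 : g x1 <= 1 by rewrite (le_trans (ler_norm _))// (le_trans (g1 x1))// x11.
have fzs : f z <= s by rewrite (le_trans (ler_norm _))// fs.
have gx : 0 < g x1.
  rewrite ltNge; apply/negP => gx; have := mulr_ge0_le0 fz0 gx; lra.
have fgz : f z * g x1 <= f z by rewrite ler_piMr.
have gx1s : s - d < s * g x1.
  have : f z * g x1 <= s * g x1 by rewrite ler_wpM2r// ltW.
  lra.
exists (fun v => 1 * f v + 1 * g v), (1 + s - 2 * d), z; split=> //.
- exact: functional_comb.
- lra.
- move=> w w1 gw.
  have gw1 : g w <= 1.
    by rewrite (le_trans (ler_norm _))// (le_trans (g1 w)).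
  have fws : f w <= s by rewrite (le_trans (ler_norm _))// fs.
  split=> [|l l0]; first lra.
  have gw0 : 0 <= g w by lra.
  apply: (@le_trans _ _ (g (x + l *: w))); last first.
    by rewrite (le_trans (ler_norm _)).
  rewrite functionalD// functionalZ//.
  have -> : g x = `|x| * g x1.
    by rewrite functionalZ// mulrA mulfV ?mul1r// normr_eq0.
  rewrite -[leLHS]addr0 lerD ?mulr_ge0//.
  rewrite ler_pdivlMr// in d3.
  rewrite -(ler_pM2l s0).
  have := ler_wpM2l (ltW nx0) (ltW gx1s).
  lra.
Qed.

Lemma nonzero_functional : exists2 f, functional f & exists v, f v != 0.
Proof.
have [x x0] := X_neq0; have [f [ff _ fx]] := norming_functional x.
by exists f => //; exists x; rewrite fx normr_eq0.
Qed.

(** When f = 0 the first slice is the whole ball and any nonzero functional, here h,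
can replace f. *)
Lemma daugavet_subslice f alpha x0 x eta : functional f ->
  `|x0| <= 1 -> alpha < f x0 -> 0 < eta ->
  exists g beta z, [/\ functional g, `|z| <= 1, beta < g z &
    forall w, `|w| <= 1 -> beta < g w ->
      alpha < f w /\ forall l, 0 <= l -> `|x| - eta <= `|x + l *: w|].
Proof.
move=> ff x01 fx0 eta0.
have [->|xne0] := eqVneq x 0.
  exists f, alpha, x0; split=> // w w1 fw; split=> // l l0.
  by rewrite normr0 sub0r (le_trans _ (normr_ge0 _))// oppr_le0 ltW.
have [fne0|f0] := pselect (exists v, f v != 0).
  exact: (daugavet_subslice_neq0 _ _ x0).
have {}f0 v : f v = 0.
  by apply/eqP/negP => /negP fv; apply: f0; exists v.
have [h hh hne0] := nonzero_functional.
have h0 : - 1 < h 0 by rewrite functional0//; lra.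
have n0 : `|0 : X| <= 1 by rewrite normr0.
have [g [beta [z [fg z1 gz P]]]] := daugavet_subslice_neq0 _ _ _ x _ hh hne0 n0 h0 eta0 xne0.
exists g, beta, z; split=> // w w1 gw; split; last by have [] := P w w1 gw.
by rewrite f0 -(f0 x0).
Qed.

(** Since [daugavet_subslice] produces a whole slice inside the given one, finitely
many vectors can be handled one after the other. *)
Lemma daugavet_slice_seq f alpha x0 (L : seq X) eta : functional f ->
  `|x0| <= 1 -> alpha < f x0 -> 0 < eta ->
  exists z, [/\ `|z| <= 1, alpha < f z &
    forall x, x \in L -> forall l, 0 <= l -> `|x| - eta <= `|x + l *: z|].
Proof.
move=> ff x01 fx0 eta0; elim: L f alpha x0 ff x01 fx0 => [|x L IH] f alpha x0 ff x01 fx0.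
  by exists x0; split.
have [g [beta [z [fg z1 gz P]]]] := daugavet_subslice _ _ _ x _ ff x01 fx0 eta0.
have [y [y1 gy yL]] := IH _ _ _ fg z1 gz.
have [fy yx] := P y y1 gy.
exists y; split=> // v; rewrite inE => /predU1P[->|]; first exact: yx.
exact: yL.
Qed.

Definition finite_nets K := forall e, 0 < e ->
  exists L : seq X, forall v, K v -> exists2 l, l \in L & `|v - l| <= e.

Definition almost_orthogonal K eta y :=
  forall v l, K v -> `|l| <= 1 -> `|v| - eta <= `|v + l *: y|.

(** Negative multiples are covered by applying [daugavet_slice_seq] to a finite net of K
together with its opposite. *)
Lemma daugavet_slice_orthogonal f alpha r x0 K eta : functional f -> finite_nets K ->
  0 < r -> `|x0| <= r -> alpha < f x0 -> 0 < eta ->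
  exists y, [/\ `|y| <= r, alpha < f y & almost_orthogonal K eta y].
Proof.
move=> ff Knets r0 x0r fx0 eta0.
have e0 : 0 < eta / 3 by lra.
have [L KL] := Knets _ e0.
have hf : functional (fun v => r * f v).
  have := functional_comb r 0 _ _ ff ff.
  by under eq_fun do rewrite mul0r addr0.
have [||z [z1 fz zL]] := daugavet_slice_seq _ alpha (r^-1 *: x0) (L ++ map -%R L) _ hf _ _ e0.
- by rewrite normrZ gtr0_norm ?invr_gt0// ler_pdivrMl// mulr1.
- by rewrite functionalZ// mulrA mulfV ?gt_eqF// mul1r.
exists (r *: z); split.
- by rewrite normrZ gtr0_norm// ler_piMr// ltW.
- by rewrite functionalZ.
move=> v l Kv _; have [k kL vk] := KL v Kv.
have zk : `|k| - eta / 3 <= `|k + l *: (r *: z)|.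
  rewrite scalerA; have [l0|l0] := leP 0 l.
    by apply: zL; rewrite ?mem_cat ?kL// mulr_ge0// ltW.
  have := zL (- k) _ (- (l * r)); rewrite scaleNr -opprD !normrN; apply.
    by rewrite mem_cat map_f ?orbT.
  by rewrite oppr_ge0 mulr_le0_ge0// ltW.
have := ler_normD (v - k) k; rewrite subrK.
have := ler_normB (v + l *: (r *: z)) (v - k).
by rewrite opprB [_ + (k - v)]addrC addrA subrK; lra.
Qed.

End DaugavetSlices.

(** * Totally bounded sets and convex hulls *)

Section FiniteNets.
Context {R : realType} {X : normedModType R}.
Implicit Types (y v : X) (K : set X).

Definition segment_sum K y : set X :=
  [set w | exists v l, [/\ K v, `|l| <= 1 & w = v + l *: y]].

Lemma finite_nets1 y : finite_nets [set y].
Proof.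
move=> e e0; exists [:: y] => _ ->; exists y; first exact: mem_head.
by rewrite subrr normr0 ltW.
Qed.

Lemma finite_netsU K K' : finite_nets K -> finite_nets K' ->
  finite_nets (K `|` K').
Proof.
move=> hK hK' e e0; have [L KL] := hK e e0; have [L' KL'] := hK' e e0.
exists (L ++ L') => v [/KL|/KL'] [l lL vl]; exists l => //;
  by rewrite mem_cat lL ?orbT.
Qed.

Lemma unit_interval_net (d : R) : 0 < d ->
  exists L : seq R, forall l, `|l| <= 1 -> exists2 m, m \in L & `|l - m| <= d.
Proof.
move=> d0; exists [seq - 1 + i%:R * d | i <- iota 0 (Num.truncn (2 / d)).+1].
move=> l l1; have /andP[ll lu] : - 1 <= l <= 1 by rewrite -ler_norml.
have x0 : 0 <= (l + 1) / d by rewrite divr_ge0 ?(ltW d0)//; lra.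
have /andP[] := truncn_itv x0.
set i := Num.truncn _ => il iu; exists (- 1 + i%:R * d).
  apply/mapP; exists i => //; rewrite mem_iota add0n ltnS /=.
  by apply: le_truncn; rewrite ler_pM2r ?invr_gt0//; lra.
rewrite ler_pdivlMr// in il; rewrite ltr_pdivrMr// -natr1 mulrDl mul1r in iu.
by rewrite ger0_norm; lra.
Qed.

Lemma finite_nets_segment_sum K y : finite_nets K -> finite_nets (segment_sum K y).
Proof.
move=> hK e e0.
have e20 : 0 < e / 2 by lra.
have d0 : 0 < e / 2 / (`|y| + 1) by rewrite divr_gt0// ltr_wpDl.
have [L KL] := hK _ e20; have [M HM] := unit_interval_net _ d0.
exists [seq v + l *: y | v <- L, l <- M] => _ [v [l [Kv l1 ->]]].
have [v' v'L vv'] := KL v Kv; have [l' l'M ll'] := HM l l1.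
exists (v' + l' *: y); first exact: allpairs_f.
rewrite opprD addrACA -scalerBl (le_trans (ler_normD _ _))// normrZ.
have : `|l - l'| * `|y| <= e / 2; last by lra.
rewrite ler_pdivlMr ?ltr_wpDl// in ll'.
have := normr_ge0 (l - l'); lra.
Qed.

End FiniteNets.

Section ConvexHull.
Context {R : realType} {X : normedModType R}.
Implicit Types (A B : set X).

Lemma convex_hull_convex B : convex_set (convex_hull B).
Proof.
apply/convex_setP => u v s Bu Bv s0 s1 M [cM BM].
by apply: (convex_setP _).1 => //; [exact: Bu|exact: Bv].
Qed.

Lemma sub_convex_hull B : B `<=` convex_hull B.
Proof. exact: sub_smallest. Qed.

Lemma convex_hull_min A B : convex_set A -> B `<=` A -> convex_hull B `<=` A.
Proof. by move=> cA BA v; apply. Qed.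

Lemma convex_hullS A B : A `<=` B -> convex_hull A `<=` convex_hull B.
Proof.
move=> AB; apply: convex_hull_min; first exact: convex_hull_convex.
exact: subset_trans AB (sub_convex_hull B).
Qed.

Lemma convex_hullN A B v : (forall u, A u -> B (- u)) ->
  convex_hull A v -> convex_hull B (- v).
Proof.
move=> AB; move: v; apply: (convex_hull_min [set v | convex_hull B (- v)]).
  apply/convex_setP => u v s /= Bu Bv s0 s1.
  rewrite opprD -!scalerN.
  by move: (convex_hull_convex B) => /convex_setP; apply.
by move=> u /AB; exact: sub_convex_hull.
Qed.

End ConvexHull.

(** * Almost orthogonal points in weak neighbourhoods *)

Section WeakApproximation.
Context {R : realType} {X : normedModType R}.
Hypothesis X_neq0 : exists x : X, x != 0.
Hypothesis X_daugavet : daugavet_property X.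
Implicit Types (f g : X -> R) (v x y : X) (K : set X).

(** The constant C does not depend on m: the error of the sum in R^2 moves at each step by
a bounded vector that has almost nonpositive scalar product with it, so its square
grows by a bounded amount. Each summand is almost orthogonal to K enlarged by the
multiples of the previous partial sum, which makes the sum almost orthogonal to K. *)
Lemma daugavet_sums f g r x K : functional f -> functional g ->
  finite_nets K -> 0 < r -> `|x| <= r ->
  exists2 C, 0 <= C & forall (m : nat) eta, 0 < eta ->
    exists y, [/\ `|y| <= m%:R * r,
      (f y - m%:R * f x) ^+ 2 + (g y - m%:R * g x) ^+ 2 <= m%:R * C &
      almost_orthogonal K (m%:R * eta) y].
Proof.
move=> ff fg Knets r0 xr.
have osc h : functional h ->
    exists2 c, 0 <= c & forall z, `|z| <= r -> (h z - h x) ^+ 2 <= c.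
  move=> [_ [M M0 hM]]; exists ((M * r + M * r) ^+ 2); first exact: sqr_ge0.
  move=> z zr; rewrite -real_normK ?num_real// lerXn2r ?nnegrE//.
    by rewrite -mulrDl mulr_ge0 ?addr_ge0// ltW.
  rewrite (le_trans (ler_normB _ _))// lerD//.
    by rewrite (le_trans (hM z))// ler_wpM2l// ltW.
  by rewrite (le_trans (hM x))// ler_wpM2l// ltW.
have [c c0 fc] := osc f ff; have [d d0 gd] := osc g fg.
exists (1 + c + d) => [|m eta eta0]; first lra.
elim: m => [|m [y [ym yC Ky]]].
  exists 0; split; first by rewrite normr0 mul0r.
    by rewrite !functional0// !mul0r subrr expr0n addr0.
  by move=> v l Kv _; rewrite scaler0 addr0 mul0r subr0.
set A := f y - _ in yC; set B := g y - _ in yC.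
(* the next summand is taken on the side of x opposite to the current error *)
have hh := functional_comb (- A) (- B) _ _ ff fg.
set h := (fun v => _) in hh.
have hx : h x - 1 / 2 < h x by lra.
have [z [zr hz Kz]] := daugavet_slice_orthogonal X_neq0 X_daugavet h (h x - 1 / 2)
  r x (segment_sum K y) eta hh (finite_nets_segment_sum _ y Knets) r0 xr hx eta0.
exists (y + z); split.
- by rewrite (le_trans (ler_normD _ _))// -natr1 mulrDl mul1r lerD.
- have := fc z zr; have := gd z zr.
  rewrite (functionalD f)// (functionalD g)// -natr1.
  have -> : f y + f z - (m%:R + 1) * f x = A + (f z - f x) by rewrite /A; ring.
  have -> : g y + g z - (m%:R + 1) * g x = B + (g z - g x) by rewrite /B; ring.
  rewrite /h in hz; nra.
- move=> v l Kv l1.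
  have := Ky v l Kv l1; rewrite -natr1 => h1.
  have := Kz (v + l *: y) l _ l1; rewrite -addrA -scalerDr => h3.
  have : segment_sum K y (v + l *: y) by exists v, l.
  by move=> /h3; lra.
Qed.

(** Dividing the sum of m terms of [daugavet_sums] by m leaves an error of order
1 / sqrt m. *)
Lemma daugavet_weak_approximation f g r x K eta : functional f -> functional g ->
  finite_nets K -> 0 < r -> `|x| <= r -> 0 < eta ->
  exists y, [/\ `|y| <= r, `|f y - f x| < eta, `|g y - g x| < eta &
    almost_orthogonal K eta y].
Proof.
move=> ff fg Knets r0 xr eta0.
have [C C0 CP] := daugavet_sums _ _ _ _ _ ff fg Knets r0 xr.
pose m := (Num.truncn (C / eta ^+ 2)).+1.
have m0 : 0 < m%:R :> R by rewrite ltr0n.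
have mC : C < m%:R * eta ^+ 2.
  by rewrite -ltr_pdivrMr ?exprn_gt0// truncnS_gt.
have [y [ym yC Ky]] := CP m (eta / m%:R) (divr_gt0 eta0 m0).
have close h A : functional h -> A = h y - m%:R * h x ->
    A ^+ 2 <= m%:R * C -> `|h (m%:R^-1 *: y) - h x| < eta.
  move=> hh -> hA.
  have -> : h (m%:R^-1 *: y) - h x = m%:R^-1 * (h y - m%:R * h x).
    by rewrite functionalZ// mulrBr mulrA mulVf ?mul1r// gt_eqF.
  rewrite normrM gtr0_norm ?invr_gt0// ltr_pdivrMl//.
  rewrite -ltr_sqr ?nnegrE ?(mulr_ge0 (ltW m0) (ltW eta0))//.
  rewrite real_normK ?num_real// (le_lt_trans hA)// exprMn expr2 -mulrA.
  by rewrite ltr_pM2l.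
exists (m%:R^-1 *: y); split.
- by rewrite normrZ gtr0_norm ?invr_gt0// ler_pdivrMl.
- by apply: (close f _ ff erefl); have := sqr_ge0 (g y - m%:R * g x); lra.
- by apply: (close g _ fg erefl); have := sqr_ge0 (f y - m%:R * f x); lra.
- move=> v l Kv l1; rewrite scalerA.
  have -> : eta = m%:R * (eta / m%:R) by rewrite mulrC divfK// gt_eqF.
  apply: Ky => //; rewrite normrM [`|_^-1|]gtr0_norm ?invr_gt0//.
  by rewrite ler_pdivrMr// mul1r (le_trans l1)// ler1n.
Qed.

End WeakApproximation.

(** * One stage of the construction *)

Section Stage.
Context {R : realType} {X : normedModType R}.
Hypothesis X_neq0 : exists x : X, x != 0.
Hypothesis X_daugavet : daugavet_property X.
Variables (phi : X -> R) (e : X) (r : R).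
Hypothesis phi_functional : functional phi.
Hypothesis phi_e : phi e = 1.
Hypothesis e_lt_r : `|e| < r.
Implicit Types (v x y : X) (K : set X).

(** Norms below r are required of the two endpoints and not only of x: new points are
placed near the endpoints, so this keeps all stages in the ball of radius r. *)
Definition between_faces : set X :=
  [set x | exists a b t, [/\ `|a| < r /\ `|b| < r, phi a = 1 /\ phi b = - 1,
    0 < t < 1 & x = t *: a + (1 - t) *: b]].

Let r_gt0 : 0 < r. Proof. exact: le_lt_trans e_lt_r. Qed.

Lemma between_faces_norm x : between_faces x -> `|x| < r.
Proof.
move=> [a [b [t [[ar br] _ /andP[t0 t1] ->]]]].
rewrite (le_lt_trans (ler_normD _ _))// !normrZ gtr0_norm// gtr0_norm ?subr_gt0//.
have : t * `|a| < t * r by rewrite ltr_pM2l.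
have : (1 - t) * `|b| < (1 - t) * r by rewrite ltr_pM2l ?subr_gt0.
lra.
Qed.

Lemma between_facesN x : between_faces x -> between_faces (- x).
Proof.
move=> [a [b [t [[ar br] [pa pb] /andP[t0 t1] ->]]]].
exists (- b), (- a), (1 - t); split.
- by rewrite !normrN.
- by rewrite !(functionalN phi)// pa pb opprK.
- by rewrite subr_gt0 t1/=; lra.
- by rewrite subKr opprD addrC !scalerN.
Qed.

(** Writing y = t a + (1 - t) (- e) with t = (1 + phi y) / 2 forces a onto the face phi = 1,
and |a| < r amounts to the second hypothesis because |e| < r. *)
Lemma between_facesP y : phi y < 1 -> `|y| < r * phi y -> between_faces y.
Proof.
move=> y1 yr.
have y0 : 0 < phi y.
  by rewrite -(pmulr_rgt0 _ r_gt0); apply: le_lt_trans yr.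
pose t := (1 + phi y) / 2.
have t0 : 0 < t by rewrite /t; lra.
have t1 : t < 1 by rewrite /t; lra.
exists (t^-1 *: (y + (1 - t) *: e)), (- e), t; split.
- split; last by rewrite normrN.
  rewrite normrZ gtr0_norm ?invr_gt0// ltr_pdivrMl//.
  rewrite (le_lt_trans (ler_normD _ _))// normrZ gtr0_norm ?subr_gt0//.
  have : (1 - t) * `|e| < (1 - t) * r by rewrite ltr_pM2l ?subr_gt0.
  rewrite /t; lra.
- rewrite (functionalN phi)// (functionalZ phi)// (functionalD phi)//.
  rewrite (functionalZ phi)// phi_e.
  split=> //; rewrite /t; field.
  by move: t0; rewrite /t; lra.
- by rewrite t0.
- by rewrite scalerA mulfV ?gt_eqF// scale1r scalerN addrK.
Qed.

Definition stage_point K eps : set X := [set y |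
  [/\ between_faces y, 1 - eps < `|phi y| & almost_orthogonal K eps y]].

Lemma stage_pointN K eps y : stage_point K eps y -> stage_point K eps (- y).
Proof.
move=> [yb py Ky]; split; first exact: between_facesN.
  by rewrite functionalN// normrN.
by move=> v l Kv l1; rewrite scalerN -scaleNr; apply: Ky; rewrite ?normrN.
Qed.

(** If the convex hulls of finite sets of stage points stayed at distance eps from a,
a contractive functional f would separate them from a by eps. A point y with phi y
and f y close to their values at (1 - k) a, for a small k, is a stage point: the
factor 1 - k makes phi y < 1 strictly. But f y > f a - eps. *)
Lemma stage_point_hull a K eps : finite_nets K -> 0 < eps ->
  `|a| < r -> phi a = 1 ->
  exists s : seq X, (forall y, y \in s -> stage_point K eps y) /\
    exists2 h, convex_hull [set` s] h & `|a - h| < eps.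
Proof.
move=> Knets eps0 ar pa.
pose T : set X := [set h | exists2 s : seq X,
  forall y, y \in s -> stage_point K eps y & convex_hull [set` s] h].
have cT : convex_set T.
  apply/convex_setP => u v c [s sK us] [s' s'K vs'] c0 c1.
  exists (s ++ s') => [y|]; first by rewrite mem_cat => /orP[/sK|/s'K].
  apply: ((convex_setP _).1 (convex_hull_convex [set` s ++ s'])) => //.
    by apply: convex_hullS us => y /= ys; rewrite mem_cat ys.
  by apply: convex_hullS vs' => y /= ys; rewrite mem_cat ys orbT.
apply: contrapT => noT.
have [||f [ff f1 fT]] := Hahn_Banach_separation T a eps cT; first exact: ltW.
  move=> t [s sK ts]; rewrite leNgt; apply/negP => at_; apply: noT.
  by exists s; split=> //; exists t.
have a0 : 0 < `|a|.
  rewrite normr_gt0; apply/eqP => a0; move: pa; rewrite a0 functional0//.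
  by move/esym/eqP; rewrite oner_eq0.
(* the bounds on k give, in order: 1 - k >= 0, 1 - eps < phi y, |a| < r phi y, and
   f y > f a - eps *)
pose k := Num.min (Num.min (1 / 2) (eps / 2))
                  (Num.min ((r - `|a|) / (4 * r)) (eps / (`|a| + 1))).
have k0 : 0 < k by rewrite !lt_min !divr_gt0 ?subr_gt0 ?mulr_gt0 ?ltr_wpDl.
have k1 : k <= 1 / 2 by rewrite !ge_min lexx.
have k2 : k <= eps / 2 by rewrite !ge_min lexx !orbT.
have k3 : k <= (r - `|a|) / (4 * r) by rewrite !ge_min lexx !orbT.
have k4 : k <= eps / (`|a| + 1) by rewrite !ge_min lexx !orbT.
rewrite ler_pdivlMr ?mulr_gt0// in k3; rewrite ler_pdivlMr ?ltr_wpDl// in k4.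
have xa : `|(1 - k) *: a| <= `|a|.
  by rewrite normrZ ger0_norm; [rewrite ler_piMl//; lra|lra].
have k20 : 0 < k / 2 by lra.
have [y [ya py fy Ky]] := daugavet_weak_approximation X_neq0 X_daugavet
  _ _ _ _ _ _ phi_functional ff Knets a0 xa k20.
rewrite functionalZ// pa mulr1 in py; rewrite functionalZ// in fy.
move: py fy; rewrite !ltr_norml => /andP[py1 py2] /andP[fy1 _].
have sy : stage_point K eps y.
  split.
  - apply: between_facesP; first lra.
    apply: (le_lt_trans ya).
    have : r * (1 - k - k / 2) < r * phi y by rewrite ltr_pM2l//; lra.
    lra.
  - by rewrite ger0_norm; lra.
  - by move=> v l Kv l1; apply: le_trans (Ky v l Kv l1); rewrite lerD2l lerN2; lra.
have : T y.
  exists [:: y] => [z|]; first by rewrite inE => /eqP ->.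
  by apply: sub_convex_hull; rewrite /= mem_head.
move=> /fT; have : k * f a <= k * `|a|.
  by rewrite ler_pM2l// (le_trans (ler_norm _)).
lra.
Qed.

(** Each p of P is a convex combination of points a and b of the two faces; a and - b lie
on the face phi = 1 and are handled by [stage_point_hull], and adding the opposite
points makes the stage symmetric. *)
Lemma next_stage (P : seq X) K eps : finite_nets K -> 0 < eps ->
  (forall p, p \in P -> between_faces p) ->
  exists s : seq X,
    (forall y, y \in s -> stage_point K eps y /\ - y \in s) /\
    forall p, p \in P -> exists2 h, convex_hull [set` s] h & `|p - h| <= eps.
Proof.
move=> Knets eps0; elim: P => [|p P IH] PF; first by exists [::].
have [s [sK sP]] : exists s : seq X,
    (forall y, y \in s -> stage_point K eps y /\ - y \in s) /\
    forall p, p \in P -> exists2 h, convex_hull [set` s] h & `|p - h| <= eps.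
  by apply: IH => q qP; apply: PF; rewrite inE qP orbT.
have [a [b [t [[ar br] [pa pb] /andP[t0 t1] pE]]]] := PF p (mem_head _ _).
have [sa [saK [ha hasa aha]]] := stage_point_hull _ _ _ Knets eps0 ar pa.
have br' : `|- b| < r by rewrite normrN.
have pb' : phi (- b) = 1 by rewrite functionalN// pb opprK.
have [sb [sbK [hb hbsb bhb]]] := stage_point_hull _ _ _ Knets eps0 br' pb'.
pose s1 := sa ++ sb.
exists (s ++ s1 ++ map -%R s1).
have s1K y : y \in s1 -> stage_point K eps y.
  by rewrite mem_cat => /orP[/saK|/sbK].
have s1N y : y \in s1 -> - y \in map -%R s1 by exact: map_f.
split=> [y|q].
  rewrite !(mem_cat _ s) !(mem_cat _ s1) => /or3P[ys|ys|/mapP[z zs ->]].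
  - by have [? ->] := sK y ys.
  - by split; [exact: s1K|rewrite s1N// !orbT].
  - by split; [exact/stage_pointN/s1K|rewrite opprK zs orbT].
rewrite inE => /predU1P[->{q}|/sP[h hs qh]]; last first.
  by exists h => //; apply: convex_hullS hs => y /= ys; rewrite mem_cat ys.
exists (t *: ha + (1 - t) *: (- hb)).
  apply: ((convex_setP _).1 (convex_hull_convex _)) => //; last 2 first.
  - exact: ltW.
  - exact: ltW.
  - apply: convex_hullS hasa => y /= ys.
    by rewrite !mem_cat ys !orbT.
  - apply: convex_hullN hbsb => y /= ys.
    by rewrite !(mem_cat _ s) (mem_cat _ s1) s1N ?orbT// mem_cat ys orbT.
rewrite pE opprD addrACA -!scalerBr (le_trans (ler_normD _ _))// !normrZ.
rewrite gtr0_norm// gtr0_norm ?subr_gt0//.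
have -> : `|b - (- hb)| = `|- b - hb| by rewrite opprK -normrN opprD.
have : t * `|a - ha| <= t * eps by rewrite ler_wpM2l// ltW.
have : (1 - t) * `|- b - hb| <= (1 - t) * eps by rewrite ler_wpM2l ?subr_ge0// ltW.
lra.
Qed.

End Stage.

(** * Weakly open sets *)

Section WeakTopology.
Context {R : realType} {X : normedModType R}.
Implicit Types (f : X -> R) (u x : X).

Lemma weak_open_preimage f (A : set R) : functional f -> open A ->
  open (f @^-1` A : set (weak_space X)).
Proof.
move=> /functional_dual[g <-] Aopen.
rewrite openE => x Ax; rewrite /interior.
pose Tc (h : dual X) := Topological.class (initial_topology (h : X -> R^o)).
have [/(_ (fun _ xB => xB))/(_ g) + _] :=
  @cvg_sup X (dual X) Tc (nbhs (x : weak_space X)) x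
    (@nbhs_filter (weak_space X) x).
apply; apply: (@open_nbhs_nbhs (initial_topology (g : X -> R^o))).
by split=> //; exists A.
Qed.

Lemma weak_open_avoid u (L : seq X) : exists W : set (weak_space X),
  [/\ open W, W u & forall p, p \in L -> p != u -> ~ W p].
Proof.
elim: L => [|p L [W [oW Wu WL]]].
  by exists setT; split=> //; exact: openT.
have [->|pu] := eqVneq p u.
  exists W; split=> // q; rewrite inE => /predU1P[->|]; last exact: WL.
  by rewrite eqxx.
have [f [ff _ fp]] := norming_functional (p - u).
exists (W `&` (f @^-1` [set y | y < f p] : set (weak_space X))); split.
- by apply: openI => //; apply: weak_open_preimage => //; exact: open_lt.
- by split=> //=; rewrite -subr_gt0 -functionalB// fp normr_gt0 subr_eq0.
- move=> q; rewrite inE => /predU1P[-> _ [_ /=]|qL qu [Wq _]].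
    by rewrite ltxx.
  exact: (WL q).
Qed.

Lemma weak_open_strip f c : functional f ->
  open ([set x | `|f x| < c] : set (weak_space X)).
Proof.
move=> ff.
have -> : [set x | `|f x| < c] =
    (f @^-1` [set y | y < c]) `&` (f @^-1` [set y | - c < y]).
  apply/seteqP; split=> x /=; rewrite ltr_norml.
    by move=> /andP[].
  by move=> [-> ->].
by apply: openI; apply: weak_open_preimage.
Qed.

End WeakTopology.

(** * The tower of stages *)

Section Tower.
Context {R : realType} {X : normedModType R}.
Hypothesis X_neq0 : exists x : X, x != 0.
Hypothesis X_daugavet : daugavet_property X.
Variables (phi : X -> R) (e : X) (r d : R) (u0 : X).
Hypothesis phi_functional : functional phi.
Hypothesis phi_e : phi e = 1.
Hypothesis e_lt_r : `|e| < r.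
Hypothesis d_gt0 : 0 < d.

Definition tolerance (n : nat) : R := d * 2^-1 ^+ n.+1.

Lemma tolerance_gt0 n : 0 < tolerance n.
Proof. by rewrite mulr_gt0// exprn_gt0// invr_gt0. Qed.

Lemma tolerance_small c : 0 < c -> exists N, forall n, (N <= n)%N -> tolerance n <= c.
Proof.
move=> c0; exists (Num.truncn (d / c)) => n Nn.
rewrite /tolerance exprVn ler_pdivrMr ?exprn_gt0// mulrC -ler_pdivrMr//.
apply: (@le_trans _ _ n.+1%:R).
  apply/ltW/(lt_le_trans (truncnS_gt _)).
  by rewrite ler_nat ltnS.
by rewrite -natrX ler_nat ltnW// ltn_expl.
Qed.

(** [points n] gathers u0, - u0 and the stages before n; [sums n] is the set of sums
u0 + l_1 y_1 + ... with |l_i| <= 1 and at most one term from each stage before n.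
Including - u0 makes the union symmetric, whence its lack of convexity. *)
Record tower := Tower {
  stage : nat -> seq X;
  points : nat -> seq X;
  sums : nat -> set X;
  points0 : points 0 = [:: u0; - u0];
  pointsS : forall n, points n.+1 = stage n ++ points n;
  sums0 : sums 0 = [set u0];
  sumsS : forall n, sums n.+1 =
    sums n `|` [set w | exists2 y, y \in stage n & segment_sum (sums n) y w];
  stageP : forall n y, y \in stage n ->
    stage_point phi r (sums n) (tolerance n) y /\ - y \in stage n;
  stage_hull : forall n p, p \in points n ->
    exists2 h, convex_hull [set` stage n] h & `|p - h| <= tolerance n }.

Lemma tower_exists : between_faces phi r u0 -> inhabited tower.
Proof.
move=> u0F.
have /choice[F FP] (i : nat * (seq X * set X)) : exists s : seq X,
    finite_nets i.2.2 -> (forall p, p \in i.2.1 -> between_faces phi r p) ->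
    (forall y, y \in s ->
      stage_point phi r i.2.2 (tolerance i.1) y /\ - y \in s) /\
    forall p, p \in i.2.1 ->
      exists2 h, convex_hull [set` s] h & `|p - h| <= tolerance i.1.
  have [[K1 P1]|] := pselect (finite_nets i.2.2 /\
      forall p, p \in i.2.1 -> between_faces phi r p).
    have [s sP] := next_stage X_neq0 X_daugavet phi e r phi_functional phi_e
      e_lt_r _ _ _ K1 (tolerance_gt0 i.1) P1.
    by exists s.
  by move=> n; exists [::] => K1 P1; exfalso; exact: n.
pose step n (a : seq X * set X) := (F (n, a) ++ a.1,
  a.2 `|` [set w | exists2 y, y \in F (n, a) & segment_sum a.2 y w]).
pose fix st n := if n is m.+1 then step m (st m) else ([:: u0; - u0], [set u0]).
have inv n : finite_nets (st n).2 /\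
    forall p, p \in (st n).1 -> between_faces phi r p.
  elim: n => [|n [Kn Pn]].
    split; first exact: finite_nets1.
    move=> p; rewrite !inE => /orP[] /eqP -> //.
    exact: between_facesN.
  have [sP _] := FP (n, st n) Kn Pn; split=> /=.
    apply: finite_netsU => //; elim: (F (n, st n)) => [|y s IH].
      by move=> c c0; exists [::] => v [].
    have -> : [set w | exists2 z, z \in y :: s & segment_sum (st n).2 z w] =
        segment_sum (st n).2 y `|`
        [set w | exists2 z, z \in s & segment_sum (st n).2 z w].
      apply/seteqP; split=> w /=.
        by move=> [z]; rewrite inE => /predU1P[->|zs] zw; [left|right; exists z].
      move=> [yw|[z zs zw]]; first by exists y => //; exact: mem_head.
      by exists z => //; rewrite inE zs orbT.
    by apply: finite_netsU => //; exact: finite_nets_segment_sum.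
  by move=> p; rewrite mem_cat => /orP[/sP[[]]|/Pn].
pose s n := F (n, st n).
constructor; apply: (@Tower s (fun n => (st n).1) (fun n => (st n).2)) => //.
- by move=> n; have [Kn Pn] := inv n; have [] := FP (n, st n) Kn Pn.
- by move=> n; have [Kn Pn] := inv n; have [] := FP (n, st n) Kn Pn.
Qed.

Variable t : tower.
Implicit Types (m n : nat) (x y v : X).

Definition tower_set : set X := [set x | exists n, x \in points t n].

Lemma points_le m n x : (m <= n)%N -> x \in points t m -> x \in points t n.
Proof.
move=> /subnK <-; elim: (n - m)%N => [|k IH] xm //.
by rewrite addSn pointsS mem_cat IH ?orbT.
Qed.

Lemma stage_tower n y : y \in stage t n -> tower_set y.
Proof. by move=> ys; exists n.+1; rewrite pointsS mem_cat ys. Qed.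

Lemma sums_le m n v : (m <= n)%N -> sums t m v -> sums t n v.
Proof.
move=> /subnK <-; elim: (n - m)%N => [|k IH] vm //.
by rewrite addSn sumsS; left; exact: IH.
Qed.

(** The tolerances of the stages before n add up to d (1 - 2^-n). *)
Lemma sums_norm n v : sums t n v -> `|u0| - d * (1 - 2^-1 ^+ n) <= `|v|.
Proof.
elim: n v => [|n IH] v.
  by rewrite sums0 => ->; rewrite expr0 subrr mulr0 subr0.
have hp : 0 < 2^-1 ^+ n.+1 :> R by rewrite exprn_gt0// invr_gt0.
have hE : 2^-1 ^+ n = 2 * 2^-1 ^+ n.+1 :> R.
  by rewrite exprS mulrA mulfV ?mul1r// pnatr_eq0.
rewrite sumsS => -[/IH|[y ys [w [l [/[dup] Kw /IH wn l1 ->]]]]].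
  by apply: le_trans; rewrite lerB// ler_pM2l// hE; lra.
have [[_ _ /(_ w l Kw l1) wy] _] := stageP t n y ys.
by rewrite /tolerance in wy; rewrite hE in wn; lra.
Qed.

(** All partial combinations of the y n with coefficients in [-1, 1] are, subtracted from
u0, elements of [sums]; they form a convex set that contains the y n. *)
Lemma selection_far (j : nat -> nat) (y : nat -> X) c :
  (forall n, (j n < j n.+1)%N) -> (forall n, y n \in stage t (j n)) ->
  convex_hull (range y) c -> `|u0| - d <= `|u0 - c|.
Proof.
move=> jS ys.
pose fix C n : set X := if n is m.+1 then segment_sum (C m) (y m) else [set 0].
pose J n := if n is m.+1 then (j m).+1 else 0%N.
have CK n v : C n v -> sums t (J n) (u0 - v).
  elim: n v => [v ->|n IH _ [v [l [Cv l1 ->]]]].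
    by rewrite sums0 subr0.
  rewrite /J sumsS; right; exists (y n); first exact: ys.
  exists (u0 - v), (- l); split; rewrite ?normrN//; last first.
    by rewrite opprD addrA scaleNr.
  by apply: sums_le (IH _ Cv); case: (n) => // m; exact: jS.
have Cle m n v : (m <= n)%N -> C m v -> C n v.
  move=> /subnK <-; elim: (n - m)%N => [|k IH] vm //.
  by rewrite addSn; exists v, 0; split; rewrite ?normr0 ?scale0r ?addr0//; exact: IH.
have Cconv n u v s : C n u -> C n v -> 0 <= s -> s <= 1 ->
    C n (s *: u + (1 - s) *: v).
  move=> + + s0 s1; elim: n u v => [u v -> ->|n IH _ _ [u [l [Cu l1 ->]]] [v [k [Cv k1 ->]]]].
    by rewrite !scaler0 addr0.
  exists (s *: u + (1 - s) *: v), (s * l + (1 - s) * k); split; first exact: IH.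
    move: l1 k1; rewrite !ler_norml => /andP[l1 l2] /andP[k1 k2]; apply/andP.
    by split; nra.
  by rewrite !scalerDr !scalerA addrACA -scalerDl.
have : convex_hull (range y) `<=` [set c | exists n, C n c].
  apply: convex_hull_min.
    apply/convex_setP => u v s [m Cu] [n Cv] s0 s1; exists (maxn m n).
    by apply: Cconv => //; [apply: Cle Cu|apply: Cle Cv]; rewrite ?leq_maxl ?leq_maxr.
  move=> _ [n _ <-]; exists n.+1, 0, 1; split; rewrite ?normr1 ?scale1r ?add0r//.
  by apply: (Cle 0%N).
move=> /[apply] -[n /CK/sums_norm].
apply: le_trans; have : 0 < 2^-1 ^+ J n :> R by rewrite exprn_gt0// invr_gt0.
by rewrite lerD2l lerN2 ler_piMr ?(ltW d_gt0)//; lra.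
Qed.

(** Late stages have x almost in their convex hull, and a convex hull leaves a closed
half-space only if one of the points does. *)
Lemma half_space_meets_stages (f : X -> R) alpha x m : functional f ->
  tower_set x -> alpha < f x ->
  exists j y, [/\ (m <= j)%N, y \in stage t j & alpha < f y].
Proof.
move=> ff [n xn] fx; have [_ [M M0 fM]] := ff.
have [|N NP] := tolerance_small ((f x - alpha) / 2 / M).
  by rewrite !divr_gt0// subr_gt0.
pose j := maxn m (maxn n N).
have [|h hs xh] := stage_hull t j x (points_le _ _ _ _ xn).
  by rewrite leq_max leq_max leqnn orbT.
have [y ys fy] : exists2 y, y \in stage t j & alpha < f y.
  apply: contrapT => noy.
  have : convex_hull [set` stage t j] `<=` [set v | f v <= alpha].
    apply: convex_hull_min => [|y /= ys].
      apply/convex_setP => u v s /= fu fv s0; rewrite -subr_ge0 => s1.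
      rewrite (functionalD f)// !(functionalZ f)//.
      by have := ler_wpM2l s0 fu; have := ler_wpM2l s1 fv; lra.
    by rewrite leNgt; apply/negP => fy; apply: noy; exists y.
  move=> /(_ h hs) /=; apply/negP; rewrite -ltNge.
  have := le_trans (ler_norm _) (fM (x - h)); rewrite functionalB//.
  have := le_trans xh (NP j _); rewrite !leq_max leqnn !orbT => /(_ isT).
  rewrite ler_pdivlMr//; lra.
by exists j, y; split=> //; rewrite leq_max leqnn.
Qed.

Lemma tower_not_scd : d < `|u0| -> ~ scd tower_set.
Proof.
move=> du0 [S [sliceS [Stower detS]]].
have /choice[F FP] (i : nat * nat) : exists jy : nat * X,
    [/\ (i.2 <= jy.1)%N, jy.2 \in stage t jy.1 & S i.1 jy.2].
  have [[x Sx] [f [c [_ _ SE]]]] := sliceS i.1.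
  rewrite SE in Sx; have [Ux fx] := Sx.
  have [j [y [ij ys fy]]] :=
    half_space_meets_stages f _ x i.2 (dual_functional f) Ux fx.
  exists (j, y); split=> //=; rewrite SE; split=> //.
  exact: stage_tower ys.
(* J n is the first stage after those used for the slices before n *)
pose fix J n := if n is m.+1 then (F (m, J m)).1.+1 else 0%N.
pose j n := (F (n, J n)).1; pose y n := (F (n, J n)).2.
have jS n : (j n < j n.+1)%N by have [] := FP (n.+1, J n.+1).
have ys n : y n \in stage t (j n) by have [] := FP (n, J n).
have yS n : S n (y n) by have [] := FP (n, J n).
have : tower_set u0 by exists 0%N; rewrite points0 mem_head.
have gap : 0 < `|u0| - d by rewrite subr_gt0.
move=> /(detS (range y) (fun n => ex_intro _ _ (conj (ex_intro2 _ _ n I erefl) (yS n)))).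
move=> /(_ _ (nbhsx_ballx u0 _ gap))[c [/(selection_far _ _ _ jS ys)]].
by rewrite -ball_normE /= => h1 h2; have := le_lt_trans h1 h2; rewrite ltxx.
Qed.

Lemma points_between_faces n p : between_faces phi r u0 ->
  p \in points t n -> between_faces phi r p.
Proof.
move=> u0F; elim: n => [|n IH].
  rewrite points0 !inE => /orP[] /eqP -> //; exact: between_facesN.
by rewrite pointsS mem_cat => /orP[/stageP[[]]|/IH].
Qed.

Lemma tower_bounded : between_faces phi r u0 -> bounded_set tower_set.
Proof.
move=> u0F; exists r; split; first exact: num_real.
move=> M rM x [n xn]; apply: ltW; apply: lt_trans rM.
exact: between_faces_norm (points_between_faces _ _ u0F xn).
Qed.

(** The midpoint 0 of u0 and - u0 is missing, as phi vanishes nowhere on the tower. *)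
Lemma tower_not_convex : 0 < phi u0 -> d <= 1 -> ~ convex_set tower_set.
Proof.
move=> pu0 d1 /convex_setP cU.
have u0U : tower_set u0 by exists 0%N; rewrite points0 mem_head.
have Nu0U : tower_set (- u0) by exists 0%N; rewrite points0 !inE eqxx orbT.
have /= := cU u0 (- u0) (1 / 2) u0U Nu0U; rewrite scalerN.
have -> : 1 - 1 / 2 = 1 / 2 :> R by lra.
rewrite subrr => -[||n]; [lra|lra|].
have pU p : p \in points t n -> 0 < `|phi p|.
  elim: n p => [|n IH] p.
    rewrite points0 !inE => /orP[] /eqP ->; rewrite ?(functionalN phi)// ?normrN.
      by rewrite gtr0_norm.
    by rewrite gtr0_norm.
  rewrite pointsS mem_cat => /orP[/stageP[[_ + _] _]|/IH//].
  apply: le_lt_trans; rewrite subr_ge0 /tolerance.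
  by rewrite mulr_ile1 ?(ltW d_gt0)// ?exprn_ge0 ?exprn_ile1// ?invr_ge0// invf_le1// ler1n.
by move=> /pU; rewrite functional0// normr0 ltxx.
Qed.

Lemma between_faces_strip x : between_faces phi r x -> `|phi x| < 1.
Proof.
move=> [a [b [s [_ [pa pb] /andP[s0 s1] ->]]]].
rewrite (functionalD phi)// !(functionalZ phi)// pa pb ltr_norml.
by apply/andP; split; lra.
Qed.

Lemma tower_discrete u : between_faces phi r u0 -> tower_set u ->
  relatively_weakly_open tower_set [set u].
Proof.
move=> u0F [k uk].
have pu := between_faces_strip _ (points_between_faces _ _ u0F uk).
pose c := (1 + `|phi u|) / 2.
have [N NP] : exists N, forall n, (N <= n)%N -> tolerance n <= 1 - c.
  by apply: tolerance_small; rewrite /c; lra.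
have low n x : `|phi x| < c -> x \in points t n -> x \in points t N.
  move=> xc; elim: n => [|n IH]; first exact: points_le.
  rewrite pointsS mem_cat => /orP[xs|/IH//].
  have [Nn|nN] := leqP N n; last first.
    by apply: (points_le n.+1) => //; rewrite pointsS mem_cat xs.
  have [[_ + _] _] := stageP t n x xs.
  by have := NP n Nn; lra.
have [W [oW Wu WN]] := weak_open_avoid u (points t N).
exists (W `&` [set x | `|phi x| < c]).
  by apply: openI => //; exact: weak_open_strip.
apply/seteqP; split=> x /=.
  by move=> ->; split; [exists k|split=> //=; rewrite /c; lra].
move=> [[n xn] [Wx /= xc]]; apply/eqP/negPn/negP => xu.
exact: WN (low n x xc xn) xu Wx.
Qed.

Lemma tower_determining_sequence : between_faces phi r u0 ->
  exists V : nat -> set X, (forall n, relatively_weakly_open tower_set (V n)) /\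
    determining tower_set V.
Proof.
move=> u0F.
have size_gt0 n : (0 < size (points t n))%N.
  by elim: n => [|n IH]; rewrite ?points0// pointsS size_cat addn_gt0 IH orbT.
(* enumeration of pairs (stage, position), out-of-range positions giving u0 *)
pose w (i : nat) : X :=
  if unpickle i is Some (n, k) then nth u0 (points t n) k else u0.
have u0U : tower_set u0 by exists 0%N; rewrite points0 mem_head.
have wU i : tower_set (w i).
  rewrite /w; case: unpickle => [[n k]|//].
  have [kn|kn] := ltnP k (size (points t n)); first by exists n; exact: mem_nth.
  by rewrite nth_default.
have wE x : tower_set x -> exists i, w i = x.
  move=> [n xn]; exists (pickle (n, index x (points t n))).
  by rewrite /w pickleK nth_index.
exists (fun i => [set w i]); split=> [i|]; first exact: tower_discrete.
split=> [i|B Bw x Ux]; first by split=> [|_ ->//]; exists (w i).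
apply: subset_closure; apply: sub_convex_hull.
by have [i <-] := wE x Ux; have [z [Bz /= <-]] := Bw i.
Qed.

End Tower.

Theorem proposition2p6 (R : realType) (X : completeNormedModType R)
  (X_neq0 : exists x : X, x != 0) (X_daugavet : daugavet_property X) :
  exists U : set X,
    [/\ bounded_set U, ~ convex_set U, ~ scd U &
      exists V : nat -> set X,
        (forall n, relatively_weakly_open U (V n)) /\ determining U V].
Proof.
have [e0 e0_neq0] := X_neq0.
have [phi0 [phi_fun _ phi_e0]] := norming_functional e0.
pose e := (phi0 e0)^-1 *: e0; pose r := `|e| + 1.
have phi_e : phi0 e = 1.
  by rewrite functionalZ// mulVf// phi_e0 normr_eq0.
have er : `|e| < r by rewrite ltrDl.
pose u0 := (1 / 2) *: e.
have phi_u0 : phi0 u0 = 1 / 2 by rewrite functionalZ// phi_e mulr1.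
have u0F : between_faces phi0 r u0.
  exists e, (- e), (3 / 4); split.
  - by rewrite normrN.
  - by rewrite functionalN// phi_e.
  - by apply/andP; split; lra.
  - by rewrite scalerN -scaleNr -scalerDl; congr (_ *: _); lra.
have u0_gt0 : 0 < `|u0|.
  rewrite normr_gt0; apply/eqP => u00; move: phi_u0.
  by rewrite u00 functional0//; lra.
pose d := Num.min 1 (`|u0| / 2).
have d0 : 0 < d by rewrite lt_min ltr01/= divr_gt0.
have d1 : d <= 1 by rewrite ge_min lexx.
have du0 : d < `|u0|.
  by apply: (@le_lt_trans _ _ (`|u0| / 2)); [rewrite ge_min lexx orbT|lra].
have [t] := tower_exists X_neq0 X_daugavet phi0 e r d u0 phi_fun phi_e er d0 u0F.
exists (tower_set _ _ _ _ t); split.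
- exact: tower_bounded.
- by apply: tower_not_convex => //; rewrite phi_u0; lra.
- exact: tower_not_scd.
- exact: tower_determining_sequence.
Qed.
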